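(* Let $\lambda$ be a regular uncountable cardinal. (1) If $f$ is the function on $\lambda$ given by $f(\alpha)=\lambda$ if $\alpha$ is a limit ordinal and $f(\alpha)=1$ otherwise, then $I_f[\lambda]=I[\lambda]$. (2) $I_1[\lambda]=I^{\square}[\lambda]$. (3) If $f$ is given by $f(i)=|i|$ for $i<\lambda$, then $I_f[\lambda]=I^{\mathrm w\square}[\lambda]$. (4) $\lambda\setminus S^{\mathrm{in}}_\lambda\in I_\lambda[\lambda]$.
   Context: For a set of ordinals $C$, $\mathrm{acc}(C)=\{\alpha\in C:\alpha=\sup(C\cap\alpha)\}$ and $\mathrm{nacc}(C)=C\setminus\mathrm{acc}(C)$. An inaccessible is a regular limit cardinal $>\aleph_0$, and $S^{\mathrm{in}}_\lambda$ is the set of inaccessibles $<\lambda$. The family $I_{<f}[\lambda]$. For a function $f$ from $\lambda$ to the cardinals, $I_{<f}[\lambda]$ is the family of all $S\subseteq\lambda$ for which there are $S^+\subseteq\lambda$ with $S\setminus S^+$ nonstationary and a sequence $\bar C=\langle C_\delta:\delta\in S^+\rangle$ such that: (a) $C_\delta$ is a closed subset of $\delta$; (b) $\mathrm{otp}(C_\delta)<\delta$; (c) if $\delta\in S^+$ is a limit ordinal then $\delta=\sup(C_\delta)$; (d) $\mathrm{nacc}(C_\delta)$ is a set of successor ordinals; (e) for every $\beta<\lambda$ the set $\{C_\delta\cap\beta:\ \delta\in S^+,\ \beta\in C_\delta\}$ has cardinality $<f(\beta)$. For a function $g$ from $\lambda$ to the cardinals, $I_g[\lambda]:=I_{<f}[\lambda]$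 where $f(i)=g(i)^+$ for all $i$ (cardinal successor; for finite $n$, $n^+=n+1$). For a cardinal $\mu$, $I_\mu[\lambda]$ means $I_g[\lambda]$ with $g$ constantly equal to $\mu$. The family $I^\square[\lambda]$. $S^+\subseteq\lambda$ has a square if there is a sequence $\langle C_\delta:\delta\in S^+\rangle$ such that: (a) $C_\delta$ is a closed subset of $\delta$; (b) $\beta\in C_\delta$ implies $\beta\in S^+$ and $C_\beta=\beta\cap C_\delta$; (c) for $\beta\in S^+$, $\beta$ is a limit ordinal iff $\beta=\sup(C_\beta)$; (d) $\mathrm{otp}(C_\delta)<\delta$. $I^\square[\lambda]$ is the family of all $S\subseteq\lambda$ such that $S\setminus S^+$ is nonstationary for some $S^+\subseteq\lambda$ which has a square. The family $I^{\mathrm w\square}[\lambda]$. It consists of all $S\subseteq\lambda$ for which there are $S^+\subseteq\lambda$ with $S\setminus S^+$ nonstationary and a sequence $\langle\mathcal P_\delta:\delta\in S^+\rangle$ such that: (a) each $\mathcal P_\delta$ is a nonempty family of closed subsets of $\delta$, and if $\delta$ is a limit ordinal, all members of $\mathcal P_\delta$ are unbounded in $\delta$; (b) $\beta\in a\in\mathcal P_\delta$ implies $\beta\in S^+$ and $a\cap\beta\in\mathcal P_\beta$; (c) $|\mathcal P_\delta|\le|\delta|$; (d) $a\in\mathcal P_\delta$ implies $\mathrm{otp}(a)<\delta$. The family $I[\lambda]$. It consists of all $S\subseteq\lambda$ for which there are $S^+\subseteq\lambda$ with $S\setminus S^+$ nonstationary and a sequence $\langle C_\delta:\delta<\lambda\rangle$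 such that: (a) $C_\delta$ is a closed subset of $\delta$; (b) if $\alpha\in\mathrm{nacc}(C_\delta)$ then $C_\alpha=\alpha\cap C_\delta$; (c) if $\delta\in S^+$ then $\delta=\sup(C_\delta)$ and $\mathrm{otp}(C_\delta)=\mathrm{cf}(\delta)<\delta$; (d) $\mathrm{nacc}(C_\delta)$ is a set of successor ordinals. *)

(* Defs.v *)
From mathcomp Require Import all_boot all_order.
From mathcomp Require Import all_classical wochoice.

Set Implicit Arguments.
Unset Strict Implicit.
Unset Printing Implicit Defensive.

Local Open Scope order_scope.
Local Open Scope card_scope.
Local Open Scope classical_set_scope.

(* The cardinal lambda is a well-ordered type L whose elements are the        *)
(* ordinals below lambda. An ordinal alpha <= lambda is identified with the   *)
(* set of its elements, an initial segment of L: [below a] for a < lambda,    *)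
(* and [set: L] for lambda itself. A sequence indexed by a set of ordinals    *)
(* below lambda is a total function on L; its values off the index set are    *)
(* never used.                                                                *)

Definition card_lt (T U : Type) (A : set T) (B : set U) : Prop :=
  (A #<= B) /\ ~ (B #<= A).

(* A type stands for the cardinal number of its elements. Naming the universe *)
(* keeps all cardinals, in particular X, Y and Z below, at a single level.    *)
Definition cardinal := Type.

(* Y = X^+, also for finite X *)
Definition is_card_succ (X Y : cardinal) : Prop :=
  card_lt [set: X] [set: Y] /\
  forall Z : cardinal, card_lt [set: X] [set: Z] -> [set: Y] #<= [set: Z].

Section Ordinals.
Context {d : Order.disp_t} {L : orderType d}.
Implicit Types (a b e : L) (A B C D E S : set L).

Definition below a : set L := [set x | x < a].

Definition is_initial D : Prop := forall x y, x <= y -> D y -> D x.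

Definition is_succ_ordinal a : Prop :=
  exists b, b < a /\ forall x, b < x -> a <= x.

Definition is_limit_ordinal a : Prop :=
  below a !=set0 /\ ~ is_succ_ordinal a.

(* otp A = E *)
Definition has_otp A E : Prop :=
  is_initial E /\
  exists F : L -> L, {in A &, {homo F : x y / x < y}} /\ F @` A = E.

Definition otp_lt A a : Prop := exists e, e < a /\ has_otp A (below e).

Definition unbounded_in A D : Prop :=
  A `<=` D /\ forall x, D x -> exists2 y, A y & x <= y.

(* cf D = E *)
Definition has_cf D E : Prop :=
  (exists A, unbounded_in A D /\ has_otp A E) /\
  forall A E', unbounded_in A D -> has_otp A E' -> E `<=` E'.

(* D is an initial ordinal *)
Definition is_cardinal D : Prop := forall a, D a -> card_lt (below a) D.

Definition is_regular_cardinal D : Prop :=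
  [/\ is_cardinal D, infinite_set D & has_cf D D].

(* every cardinal k < D has a cardinal k' with k < k' < D *)
Definition is_limit_cardinal D : Prop :=
  forall k, D k -> is_cardinal (below k) ->
  exists k', [/\ k < k', D k' & is_cardinal (below k')].

Definition is_inaccessible a : Prop :=
  [/\ is_regular_cardinal (below a), is_limit_cardinal (below a)
    & ~ countable (below a)].

Definition S_in : set L := [set a | is_inaccessible a].

(* isLub set0 a holds for the least a only, i.e. sup of the empty set is 0.   *)
Definition acc C : set L := [set a | C a /\ isLub (C `&` below a) a].
Definition nacc C : set L := C `\` acc C.

Definition closed_subset C D : Prop :=
  C `<=` D /\
  forall a, D a -> is_limit_ordinal a -> isLub (C `&` below a) a -> C a.

Definition is_club E : Prop :=
  closed_subset E [set: L] /\ unbounded_in E [set: L].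

Definition nonstationary S : Prop := exists E, is_club E /\ S `&` E = set0.

Definition I_lt (f : L -> cardinal) : set (set L) :=
  [set S | exists Sp : set L, nonstationary (S `\` Sp) /\
   exists C : L -> set L,
   [/\ forall a, Sp a -> closed_subset (C a) (below a),
       forall a, Sp a -> otp_lt (C a) a,
       forall a, Sp a -> is_limit_ordinal a -> isLub (C a) a,
       forall a, Sp a -> forall b, nacc (C a) b -> is_succ_ordinal b
     & forall b, card_lt [set C a `&` below b | a in [set a | Sp a /\ C a b]]
                         [set: f b]]].

Definition I_fun (g : L -> cardinal) : set (set L) :=
  [set S | exists f : L -> cardinal,
    (forall b, is_card_succ (g b) (f b)) /\ I_lt f S].

Definition I_const (mu : cardinal) : set (set L) := I_fun (fun _ => mu).

Definition has_square (Sp : set L) : Prop :=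
  exists C : L -> set L,
  [/\ forall a, Sp a -> closed_subset (C a) (below a),
      forall a, Sp a -> forall b, C a b -> Sp b /\ C b = below b `&` C a,
      forall b, Sp b -> (is_limit_ordinal b <-> isLub (C b) b)
    & forall a, Sp a -> otp_lt (C a) a].

Definition I_square : set (set L) :=
  [set S | exists Sp : set L, nonstationary (S `\` Sp) /\ has_square Sp].

Definition I_wsquare : set (set L) :=
  [set S | exists Sp : set L, nonstationary (S `\` Sp) /\
   exists P : L -> set (set L),
   [/\ forall a, Sp a ->
         [/\ P a !=set0, forall A, P a A -> closed_subset A (below a)
           & is_limit_ordinal a -> forall A, P a A -> unbounded_in A (below a)],
       forall a, Sp a -> forall A b, P a A -> A b ->
         Sp b /\ P b (A `&` below b),
       forall a, Sp a -> P a #<= below a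
     & forall a, Sp a -> forall A, P a A -> otp_lt A a]].

Definition I_approach : set (set L) :=
  [set S | exists Sp : set L, nonstationary (S `\` Sp) /\
   exists C : L -> set L,
   [/\ forall a, closed_subset (C a) (below a),
       forall a b, nacc (C a) b -> C b = below b `&` C a,
       forall a, Sp a -> isLub (C a) a /\
         exists e, [/\ has_otp (C a) (below e), has_cf (below a) (below e)
                     & e < a]
     & forall a b, nacc (C a) b -> is_succ_ordinal b]].

End Ordinals.

Definition regular_uncountable_cardinal d (L : orderType d) : Prop :=
  [/\ well_order (<=%O : rel L), is_regular_cardinal [set: L]
    & ~ countable [set: L]].

Arguments I_lt {d} L f.
Arguments I_fun {d} L g.
Arguments I_const {d} L mu.
Arguments I_square {d} L.
Arguments I_wsquare {d} L.
Arguments I_approach {d} L.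
Arguments S_in {d} L.

(* Main.v *)
Require Import Defs.
From mathcomp Require Import all_boot all_order.
From mathcomp Require Import all_classical.
From mathcomp Require Import wochoice.

(** Since successor cardinals exist, a set belongs to [I_fun L g] when almost all
    its points [a] carry a short club [C a], closed in [a], of order type less than
    [a], unbounded if [a] is a limit, with successors as isolated points other than 0,
    and each [b] has at most [g b] traces [C a `&` below b] with [b] in [C a]
    ([I_funP]). Order types are handled through [rk A x], the order type of [A]
    below [x], viewed as an element of [L].

    Square and weak square sequences are coherent families, and their traces at
    [b] are members of the family at [b]; this gives one inclusion. For the other,
    the traces form a coherent family, except that the trace at [b] may have order
    type [b]. Such a [b] is a fixed point of the increasing enumeration of [C a], so
    it is at most the order type of [C a], which is less than [a]. Cutting [C a]
    above its fixed points loses only a bounded part, and the cut is coherent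
    because it only looks at initial segments ([trim], [coherent_family]).

    For the approachability ideal, one trace at each successor [b] determines a set
    to assign to [b], which gives coherence. What remains is to shrink [C a] to
    order type cf [a]. If [g] is the order type of [C a], fix a cofinal subset of
    [g] of order type cf [g] consisting of successors, and keep the elements of
    [C a] whose rank is in this subset. Since the selection depends on [g], each
    kept element [b] is replaced by a successor ordinal coding [b] and [g], and the
    closure of the set of codes is taken. The codes increase with [b], so the order
    type does not change, and they stay below [a] for club many [a]
    ([coding_exists], [I_fun_sub_approach]).

    Finally, a sequence on [L] has no more than |L| traces at a point, so the last
    claim only asks for short clubs. A limit point that carries none is regular;
    for club many points this makes it an uncountable limit cardinal, that is an
    inaccessible ([noninaccessible_short_club]). *)

Set Implicit Arguments.
Unset Strict Implicit.
Unset Printing Implicit Defensive.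

Import Order.TTheory.

Local Open Scope order_scope.
Local Open Scope card_scope.
Local Open Scope classical_set_scope.

(** * Cardinals *)

Lemma card_le_unitP (T : Type) (A : set T) :
  (A #<= [set: unit]) <-> is_subset1 A.
Proof.
split=> [/pcard_injP[f fi] x y Ax Ay|A1].
  by apply: fi; [exact/mem_set|exact/mem_set|case: (f x); case: (f y)].
by apply/pcard_injP; exists (fun=> tt) => x y /set_mem Ax /set_mem Ay _; exact: A1.
Qed.

(** Cardinals are well ordered: a maximal set of pairwise everywhere distinct
    choice functions must exhaust some [T i], otherwise it could be enlarged by
    a function avoiding all the values it takes; evaluating the members of this
    set at [i] and at [j] then injects [T i] into every [T j]. *)
Lemma card_family_min (I : Type) (T : I -> Type) (i0 : I) :
  exists i, forall j, [set: T i] #<= [set: T j].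
Proof.
pose P (M : set (forall i, T i)) :=
  forall i f g, M f -> M g -> f i = g i -> f = g.
have [|M [PM Mmax]] := @Zorn_bigcup _ P.
  move=> F FP Ft i f g [X FX Xf] [Y FY Yg].
  case: (Ft X Y FX FY) => XY; first exact: (FP _ FY i f g (XY _ Xf)).
  by apply: (FP _ FX i f g Xf); exact: XY.
have [i Mi] : exists i, forall t, exists2 f, M f & f i = t.
  apply: contrapT => no.
  have miss i : exists t, forall f, M f -> f i <> t.
    apply: contrapT => /forallNP no'; apply: no; exists i => t.
    by have /existsNP[f /not_implyP[Mf /contrapT ft]] := no' t; exists f.
  pose h i := sval (cid (miss i)).
  have hM i f : M f -> f i <> h i by exact: (svalP (cid (miss i))).
  apply: (Mmax (M `|` [set h])).
    split; first by left.
    by move=> /(_ h (or_intror erefl)) /(hM i0).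
  move=> i f g [Mf|->] [Mg|->]//; first exact: PM.
    by move=> /(hM i f Mf).
  by move=> /esym /(hM i g Mg).
exists i => j.
have Msur : [set: T i] #<= M.
  apply: (card_le_trans _ (card_image_le (fun f => f i) M)).
  by apply: subset_card_le => t _; have [f] := Mi t; exists f.
apply: (card_le_trans Msur).
have Mj : {in M &, injective (fun f : forall i, T i => f j)}.
  by move=> f g /set_mem Mf /set_mem Mg; exact: PM.
by rewrite -(card_le_eql (inj_card_eq Mj)); exact: card_leT.
Qed.

Lemma card_le_total (X Y : Type) : [set: X] #<= [set: Y] \/ [set: Y] #<= [set: X].
Proof.
have [[] h] := card_family_min (fun b : bool => if b then X else Y) true.
- by left; exact: (h false).
- by right; exact: (h true).
Qed.

Lemma cantor (X : Type) : ~ ([set: set X] #<= [set: X]).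
Proof.
move=> /card_leP[f].
pose g (A : set X) : X := val (f (to_setT A)).
have gi A B : g A = g B -> A = B.
  move=> /val_inj h; have : to_setT A = to_setT B.
    by apply: (@inj _ _ _ f); rewrite ?inE.
  by move=> /(congr1 val).
pose D := [set x | exists2 A, g A = x & ~ A x].
have nD : ~ D (g D) by move=> Dg; case: (Dg) => A /gi ->.
by apply: (nD); exists D.
Qed.

(** By Cantor's theorem some subset of [set X] does not inject into [X]; one of
    least cardinality is the successor cardinal of [X]. This works for finite
    [X] as well. *)
Lemma card_succ_exists (X : cardinal) : exists Y : cardinal, is_card_succ X Y.
Proof.
pose I := {B : set (set X) | ~ (B #<= [set: X])}.
have i0 : I by exists setT; exact: cantor.
have [[B BX] Bmin] := card_family_min (fun i : I => set_type (sval i)) i0.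
have nB : ~ ([set: B] #<= [set: X]).
  by rewrite (card_le_eql (card_setT B)).
exists (set_type B); split.
  by split=> //; have [|/nB] := card_le_total X (set_type B).
move=> Z [XZ nZX].
have [/card_leP[f]|ZX] := card_le_total Z (set X); last first.
  by apply: card_le_trans ZX; rewrite (card_le_eql (card_setT B)); exact: card_leT.
pose C := [set val (f z) | z in [set: [set: Z]]].
have CZ : C #= [set: Z].
  rewrite -(card_eqr (card_setT _)).
  by apply: inj_card_eq => x y _ _ /val_inj; apply: inj; rewrite inE.
have nC : ~ (C #<= [set: X]) by rewrite (card_le_eql CZ).
have := Bmin (exist _ C nC) => /= BC.
by apply: (card_le_trans BC); rewrite (card_le_eql (card_setT C)) (card_le_eql CZ).
Qed.

(** What turns the strict bound by [f b] in the definition of [I_lt] into a weak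
    bound by [g b], so that successor cardinals never appear again. *)
Lemma card_lt_succP (X Y : cardinal) (T : Type) (A : set T) : is_card_succ X Y ->
  (card_lt A [set: Y] <-> A #<= [set: X]).
Proof.
move=> [[XY nYX] Ymin]; split.
  move=> [AY nYA]; case: (card_le_total (set_type A) X).
    by rewrite (card_le_eql (card_setT A)).
  rewrite (card_le_eqr (card_setT A)) => XA; apply: contrapT => nAX.
  apply: nYA; rewrite -(card_le_eqr (card_setT A)); apply: Ymin; split.
    by rewrite (card_le_eqr (card_setT A)).
  by rewrite (card_le_eql (card_setT A)).
move=> AX; split; first exact: card_le_trans XY.
by move=> YA; apply: nYX; apply: card_le_trans AX.
Qed.

Lemma card_le_subset1 (T U : Type) (A : set T) (B : set U) : is_subset1 A -> B !=set0 -> A #<= B.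
Proof.
move=> A1 [y By]; have [[x Ax]|no] := pselect (A !=set0).
  apply: card_le_trans (card_image_le (fun=> x) B).
  by apply: subset_card_le => t At; exists y => //; exact: A1.
by have -> : A = set0 by apply/seteqP; split=> // x Ax; apply: no; exists x.
Qed.

(** Stated with a total [h], so that it can serve as a cofinal map of ordinals. *)
Lemma card_le_surj (T U : Type) (A : set T) (B : set U) : A #<= B -> A !=set0 ->
  exists h : U -> T, (forall y, B y -> A (h y)) /\ forall x, A x -> exists2 y, B y & h y = x.
Proof.
move=> /card_leP[f] [x0 Ax0].
have [h hP] : {h : U -> T & forall y, A (h y) /\ forall x : A, val (f x) = y -> h y = val x}.
  apply: (@choice _ _ (fun y t => A t /\ forall x : A, val (f x) = y -> t = val x)) => y.
  have [[x <-]|no] := pselect (exists x : A, val (f x) = y).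
    exists (val x); split; first exact: set_valP.
    by move=> x' /val_inj e; congr val; apply: (@inj _ _ _ f); rewrite ?inE.
  by exists x0; split=> // x xy; case: no; exists x.
exists h; split=> [y _|x Ax]; first by case: (hP y).
exists (val (f (SigSub (mem_set Ax)))); first exact: set_valP.
by have [_ /(_ _ erefl)] := hP (val (f (SigSub (mem_set Ax)))).
Qed.

(** * Order types in a well-order *)

Section WellOrder.
Context {d : Order.disp_t} {L : orderType d}.
Context (wo : well_order (<=%O : rel L)).
Implicit Types (a b x y z : L) (A B C D E X : set L).

Lemma least_exists (P : set L) : P !=set0 -> exists x, P x /\ lbound P x.
Proof.
move=> [x Px]; have [|z [[/asboolP Pz zmin] _]] := wo (A := fun x => `[< P x >]).
  by exists x; apply/asboolP.
by exists z; split=> // y Py; apply: zmin; apply/asboolP.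
Qed.

Lemma wo_lt_wf : well_founded (fun x y => x < y).
Proof.
move=> x; apply: contrapT => nx.
have [y [ny ymin]] := @least_exists [set x | ~ Acc (fun x y => x < y) x] (ex_intro _ x nx).
apply: ny; constructor=> z zy; apply: contrapT => /ymin.
by rewrite leNgt zy.
Qed.

Lemma wo_lt_ind (P : L -> Prop) : (forall x, (forall y, y < x -> P y) -> P x) -> forall x, P x.
Proof. by move=> h x; elim: (wo_lt_wf x) => y _; exact: h. Qed.

Definition least x0 (P : set L) : L := xget x0 [set x | P x /\ lbound P x].

Lemma leastP x0 (P : set L) : P !=set0 -> P (least x0 P) /\ lbound P (least x0 P).
Proof. by move=> /least_exists; exact: xgetPex. Qed.

(** The order type of [A `&` below x], as an element of [L]: it is the least
    value not taken by the Mostowski collapse of [A] before [x]. The function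
    [rk A] restricted to [A] is the collapse itself. *)
Definition rk A : L -> L := Fix wo_lt_wf (fun=> L)
  (fun x r => least x [set y | forall z (zx : z < x), A z -> r z zx <> y]).

Lemma rkE A x : rk A x = least x [set y | forall z, z < x -> A z -> rk A z <> y].
Proof.
rewrite /rk Fix_eq// => {}x f g fg.
by have -> : f = g by apply: functional_extensionality_dep => z;
  apply: functional_extensionality_dep => zx; exact: fg.
Qed.

Lemma rk_surj A x y : y < rk A x -> exists z, [/\ A z, z < x & rk A z = y].
Proof.
move=> yx; apply: contrapT => no.
have yP : [set y | forall z, z < x -> A z -> rk A z <> y] y.
  by move=> z zx Az zy; apply: no; exists z.
have [_ /(_ y yP)] := @leastP x _ (ex_intro _ y yP).
by rewrite -rkE leNgt yx.
Qed.

(** The two claims need a joint induction: [x] itself is a value not taken before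
    [x] because earlier values are at most their arguments. *)
Lemma rk_le_and_new A x : rk A x <= x /\ forall z, z < x -> A z -> rk A z <> rk A x.
Proof.
elim/wo_lt_ind: x => x ih.
have xP : [set y | forall z, z < x -> A z -> rk A z <> y] x.
  by move=> z zx Az zy; have [] := ih z zx; rewrite zy leNgt zx.
have [h1 h2] := @leastP x _ (ex_intro _ x xP).
by split; rewrite rkE//; exact: h2.
Qed.

Lemma rk_le A x : rk A x <= x.
Proof. by case: (rk_le_and_new A x). Qed.

Lemma rk_lt A x z : A z -> z < x -> rk A z < rk A x.
Proof.
move=> Az zx; rewrite ltNge le_eqVlt; apply/negP => /orP[/eqP e|h].
  by have [_ /(_ z zx Az)] := rk_le_and_new A x; rewrite e.
have [t [At tz tx]] := rk_surj h.
by have [_ /(_ t (lt_trans tz zx) At)] := rk_le_and_new A x.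
Qed.

Lemma rk_mono A x y : x <= y -> rk A x <= rk A y.
Proof.
move=> xy; rewrite leNgt; apply/negP => /rk_surj[z [Az zx]].
by move=> /eqP; rewrite (lt_eqF (rk_lt Az (lt_le_trans zx xy))).
Qed.

(** A strictly increasing map cannot decrease order types. All comparisons of
    order types below come down to exhibiting such a map. *)
Lemma rk_homo_le A B (f : L -> L) a b :
  (forall x, A x -> x < a -> B (f x) /\ f x < b) ->
  (forall x y, A x -> A y -> x < y -> y < a -> f x < f y) ->
  rk A a <= rk B b.
Proof.
elim/wo_lt_ind: a b => a ih b fAB fmono.
rewrite leNgt; apply/negP => /rk_surj[z [Az za zb]].
have [Bfz fzb] := fAB z Az za.
have : rk A z <= rk B (f z).
  apply: ih => // [x Ax xz|x y Ax Ay xy yz].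
    by split; [have [] := fAB x Ax (lt_trans xz za)|exact: fmono].
  by apply: fmono => //; exact: lt_trans za.
by rewrite leNgt zb rk_lt.
Qed.

Lemma rk_subset A B a : (forall x, x < a -> A x -> B x) -> rk A a <= rk B a.
Proof. by move=> AB; apply: (@rk_homo_le _ _ id) => // x Ax xa; split=> //; exact: AB. Qed.

Lemma eq_rk A B a : (forall x, x < a -> (A x <-> B x)) -> rk A a = rk B a.
Proof.
move=> AB; apply/eqP; rewrite eq_le; apply/andP.
by split; apply: rk_subset => x /AB[].
Qed.

Lemma rk_below A a b : a <= b -> rk (A `&` below b) a = rk A a.
Proof.
move=> ab; apply: eq_rk => x xa; split=> [[]//|Ax]; split=> //.
exact: lt_le_trans ab.
Qed.

Lemma rk_image_initial A : is_initial (rk A @` A).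
Proof.
move=> x y; rewrite le_eqVlt => /orP[/eqP->//|xy] [z Az zy].
by rewrite -zy in xy; have [t [At _ <-]] := rk_surj xy; exists t.
Qed.

Lemma has_otp_rk A : has_otp A (rk A @` A).
Proof.
split; first exact: rk_image_initial.
by exists (rk A); split=> // x y /set_mem Ax _; exact: rk_lt.
Qed.

(** Order types are unique: any strictly increasing map of [A] onto an initial
    segment is the collapse. *)
Lemma has_otpE A E : has_otp A E -> E = rk A @` A.
Proof.
move=> [Ei [F [Fmono FE]]].
have Fm x y : A x -> A y -> x < y -> F x < F y.
  by move=> Ax Ay; apply: Fmono; exact/mem_set.
have F_rk x : A x -> F x = rk A x.
  elim/wo_lt_ind: x => x ih Ax; apply/eqP; rewrite eq_le; apply/andP; split.
    rewrite leNgt; apply/negP => h.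
    have : E (rk A x) by apply: Ei (ltW h) _; rewrite -FE; exists x.
    rewrite -FE => -[z Az zx].
    have zltx : z < x.
      rewrite ltNge le_eqVlt; apply/negP => /orP[/eqP xz|/(Fm _ _ Ax Az)].
        by rewrite {2}xz zx ltxx in h.
      by rewrite zx ltNge (ltW h).
    by move: (rk_lt Az zltx); rewrite -ih// zx ltxx.
  apply: le_trans (rk_le E _); apply: (@rk_homo_le _ _ F) => [y Ay yx|y z Ay Az yz _]; last exact: Fm.
  by split; [rewrite -FE; exists y|exact: Fm].
by rewrite -FE; apply/seteqP; split=> _ [x Ax <-]; exists x; rewrite // F_rk.
Qed.

Lemma rk_image_below A a : A `<=` below a -> rk A @` A = below (rk A a).
Proof.
move=> Aa; apply/seteqP; split=> [_ [x Ax <-]|y /rk_surj[z [Az _ <-]]]; last by exists z.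
by apply: rk_lt => //; exact: Aa.
Qed.

Lemma below_inj : injective (below : L -> set L).
Proof.
move=> a b e; apply/eqP; case: ltgtP => // h.
  by have : below b a by []; rewrite -e /below /= ltxx.
by have : below a b by []; rewrite e /below /= ltxx.
Qed.

Lemma has_otp_below A a : A `<=` below a -> has_otp A (below (rk A a)).
Proof. by move=> Aa; rewrite -(rk_image_below Aa); exact: has_otp_rk. Qed.

Lemma otp_ltP A a : A `<=` below a -> (otp_lt A a <-> rk A a < a).
Proof.
move=> Aa; split=> [[e [ea /has_otpE]]|]; last by exists (rk A a); split=> //; exact: has_otp_below.
by rewrite (rk_image_below Aa) => /below_inj <-.
Qed.

(** Equivalent to [y] being the supremum of [A] below [y], see [lubP], but easier
    to transport between sets. Like the supremum condition, it holds vacuously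
    at the least element. *)
Definition clusters A y : Prop := forall x, x < y -> exists z, [/\ A z, x < z & z < y].

Lemma lubP A y : isLub (A `&` below y) y <-> clusters A y.
Proof.
split=> [[_ h] x xy|h].
  apply: contrapT => no; suff /h : ubound (A `&` below y) x by rewrite leNgt xy.
  move=> z [Az zy]; rewrite leNgt; apply/negP => xz; apply: no; by exists z.
split=> [z [_ /ltW]//|b bub]; rewrite leNgt; apply/negP => /h[z [Az bz zy]].
by have := bub z (conj Az zy); rewrite leNgt bz.
Qed.

Lemma lub_belowP C y : C `<=` below y -> (isLub C y <-> clusters C y).
Proof. by move=> Cy; rewrite -lubP setIidl. Qed.

Lemma limit_clusters y : is_limit_ordinal y -> clusters setT y.
Proof.
move=> [_ ns] x xy; apply: contrapT => no; apply: ns; exists x; split=> // z xz.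
by rewrite leNgt; apply/negP => zy; apply: no; exists z.
Qed.

Lemma clusters_limit A y : below y !=set0 -> clusters A y -> is_limit_ordinal y.
Proof.
move=> y0 h; split=> // -[b [bys hb]]; have [z [_ bz zy]] := h b bys.
by have := hb z bz; rewrite leNgt zy.
Qed.

Lemma nonlimit_succ y : below y !=set0 -> ~ is_limit_ordinal y -> is_succ_ordinal y.
Proof. by move=> y0 nl; apply: contrapT => ns; apply: nl. Qed.

Lemma clusters_sub A B y : (forall x, x < y -> A x -> B x) ->
  clusters A y -> clusters B y.
Proof. by move=> AB h x /h[z [Az xz zy]]; exists z; split=> //; exact: AB. Qed.

Lemma clusters_below A b y : y <= b -> (clusters (A `&` below b) y <-> clusters A y).
Proof.
move=> yb; split; apply: clusters_sub => x xy; first by case.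
by move=> Ax; split=> //; exact: lt_le_trans yb.
Qed.

Lemma unbounded_clusters A y : is_limit_ordinal y ->
  unbounded_in A (below y) <-> A `<=` below y /\ clusters A y.
Proof.
move=> yl; split=> [[Ay h]|[Ay h]]; split=> // x xy.
  have [z [_ xz zy]] := limit_clusters yl xy.
  by have [t At zt] := h z zy; exists t; split=> //; [exact: lt_le_trans zt|exact: Ay].
by have [z [Az xz zy]] := h x xy; exists z => //; exact: ltW.
Qed.

Lemma naccP C b : nacc C b <-> C b /\ ~ clusters C b.
Proof.
rewrite /nacc /acc /=; split=> [[Cb h]|[Cb h]]; split=> //.
  by move=> /lubP h'; apply: h.
by move=> [_ /lubP].
Qed.

Lemma succ_not_clusters C b : is_succ_ordinal b -> ~ clusters C b.
Proof. by move=> [c [cb h]] /(_ c cb)[z [_ /h]]; rewrite leNgt => /negbTE->. Qed.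

(** The order type of a set with supremum [b] has no last element. Selecting the
    points of a club whose rank is a successor therefore selects isolated
    points. *)
Lemma succ_rk_not_clusters A b : is_succ_ordinal (rk A b) -> ~ clusters A b.
Proof.
move=> [u [ub hu]] cb; have [z [Az zb uz]] := rk_surj ub.
have [t [At zt tb]] := cb z zb.
by have := hu (rk A t); rewrite -uz rk_lt// leNgt rk_lt// => /(_ isT).
Qed.

End WellOrder.

(** * Square and weak square sequences *)

Section ShortClubs.
Context {d : Order.disp_t} {L : orderType d}.
Context (wo : well_order (<=%O : rel L)).
Implicit Types (a b x y z : L) (A B E X S Sp : set L) (C : L -> set L).
Local Notation rk := (rk wo).

(** What the definition of [I_lt] demands of a single [C a], in terms of ranks and
    cluster points. *)
Definition short_club A a :=
  [/\ A `<=` below a,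
      forall x, x < a -> is_limit_ordinal x -> clusters A x -> A x,
      rk A a < a,
      is_limit_ordinal a -> clusters A a
    & forall b, A b -> ~ clusters A b -> is_succ_ordinal b].

Definition traces Sp C b : set (set L) :=
  [set C a `&` below b | a in [set a | Sp a /\ C a b]].

Lemma closed_subsetP A a : closed_subset A (below a) <->
  A `<=` below a /\ forall x, x < a -> is_limit_ordinal x -> clusters A x -> A x.
Proof.
split=> -[Aa h]; split=> // x xa xl; first by move=> /lubP; exact: h.
by move=> /lubP; exact: h.
Qed.

Lemma I_ltP (f : L -> cardinal) S : I_lt L f S <->
  exists Sp C, [/\ nonstationary (S `\` Sp), forall a, Sp a -> short_club (C a) a
    & forall b, card_lt (traces Sp C b) [set: f b]].
Proof.
split=> [[Sp [nS [C [h1 h2 h3 h4 h5]]]]|[Sp [C [nS h1 h5]]]]; exists Sp.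
  exists C; split=> // a Sa; have [Ca cl] := (closed_subsetP _ _).1 (h1 a Sa); split=> //.
  - by apply/otp_ltP => //; exact: h2.
  - by move=> al; apply/(lub_belowP Ca)/h3.
  - by move=> b Cb nb; apply: h4 Sa _ _; apply/naccP.
split=> //; exists C; split=> // a /h1[Ca cl rkC lim ns].
- exact/closed_subsetP.
- exact/(otp_ltP wo).
- by move=> al; apply/(lub_belowP Ca)/lim.
- by move=> b /naccP[Cb nb]; exact: ns.
Qed.

(** The working form of [I_fun]: choosing successor cardinals makes the bound on
    the traces weak. *)
Lemma I_funP (g : L -> cardinal) S : I_fun L g S <->
  exists Sp C, [/\ nonstationary (S `\` Sp), forall a, Sp a -> short_club (C a) a
    & forall b, traces Sp C b #<= [set: g b]].
Proof.
split=> [[f [fg /I_ltP[Sp [C [h1 h2 h3]]]]]|[Sp [C [h1 h2 h3]]]].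
  by exists Sp, C; split=> // b; apply/(card_lt_succP _ (fg b)).
have [f fg] := choice (fun b => card_succ_exists (g b)).
exists f; split=> //; apply/I_ltP; exists Sp, C; split=> // b.
exact/(card_lt_succP _ (fg b)).
Qed.

(** A coherent sequence must contain with [A] all its initial segments
    [A `&` below b] for [b] in [A], but these need not be short: the rank of [b] in
    [A] may be [b] itself. If [A] has order type less than [a], the fixed points of
    its ranks are bounded by this order type, and [trim] keeps only what lies above
    all of them. The cut depends only on initial segments of [A], which keeps
    the sequence coherent. The least element of [L] is a fixed point, hence never
    survives. *)
Definition trim A : set L := [set x | A x /\ forall y, A y -> x <= y -> rk A y < y].

(** Past a surviving [b] there is no fixed point left, so trimming commutes with
    taking the initial segment at [b]. *)
Lemma trim_below A b : trim A b -> trim A `&` below b = trim (A `&` below b).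
Proof.
move=> [Ab hb]; apply/seteqP; split=> x.
  move=> [[Ax hx] xb]; split=> // y [Ay yb] xy; rewrite (rk_below _ _ (ltW yb)); exact: hx.
move=> [[Ax xb] hx]; split=> //; split=> // y Ay xy.
case: (ltP y b) => yb; last exact: hb.
by rewrite -(rk_below _ _ (ltW yb)); apply: hx.
Qed.

Lemma trim_rk A b : trim A b -> rk A b < b.
Proof. by move=> [Ab]; apply. Qed.

(** Above [rk A b] no point below [b] is a fixed point, so a tail of [A] below [b]
    survives. *)
Lemma trim_clusters A b : rk A b < b -> (forall y, A y -> b <= y -> rk A y < y) ->
  clusters A b -> clusters (trim A) b.
Proof.
move=> rb hb Ab x xb.
have [|z [Az mz zb]] := Ab (Order.max x (rk A b)); first by rewrite gt_max xb.
move: mz; rewrite gt_max => /andP[xz rz]; exists z; split=> //; split=> // y Ay zy.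
case: (ltP y b) => yb; last exact: hb.
by apply: lt_le_trans zy; apply: lt_trans rz; exact: rk_lt.
Qed.

Lemma trim_short_club A a : short_club A a -> short_club (trim A) a.
Proof.
move=> [Aa cl rkA lim ns]; split.
- by move=> x [/Aa].
- move=> x xa xl cx; split=> [|y Ay xy].
    by apply: cl => //; apply: clusters_sub cx => z _ [].
  have [z zx] := xl.1; have [t [[_ ht] _ tx]] := cx z zx.
  by apply: ht => //; apply: le_trans xy; exact: ltW.
- by apply: le_lt_trans rkA; apply: rk_subset => x _ [].
- move=> al; apply: trim_clusters => //; last exact: lim.
  by move=> y /Aa; rewrite /below/= ltNge => /negbTE ->.
- move=> b tb nb; apply: ns tb.1 _ => cb; apply: nb; apply: trim_clusters cb; first exact: trim_rk.
  by case: tb.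
Qed.

Lemma short_club_below A a b : short_club A a -> A b -> rk A b < b ->
  short_club (A `&` below b) b.
Proof.
move=> [Aa cl rkA lim ns] Ab rb; have ba := Aa _ Ab; split.
- by move=> x [].
- move=> x xb xl; rewrite clusters_below; last exact: ltW.
  by move=> cx; split=> //; apply: cl => //; exact: lt_trans ba.
- by rewrite rk_below.
- move=> bl; rewrite clusters_below//; apply: contrapT => nb.
  by have [_] := bl; apply; exact: ns.
- move=> x [Ax xb]; rewrite clusters_below; last exact: ltW.
  exact: ns.
Qed.

(** The common core of the inclusions into the square and weak square ideals. At
    [a] take all trimmed traces of order type less than [a]; only when there is
    none, take the trimmed [C a] instead. In this way the family at [a] is never
    larger than the set of traces, except for singletons; adding [C a] always
    would spoil the bound 1 for squares and, for finite [a], the bound |a|. *)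
Lemma coherent_family Sp C : (forall a, Sp a -> short_club (C a) a) ->
  exists P : L -> set (set L),
  [/\ forall a, Sp a -> P a !=set0,
      forall a A, P a A -> short_club A a,
      forall a A b, P a A -> A b -> P b (A `&` below b)
    & forall a, P a #<= traces Sp C a \/ is_subset1 (P a)].
Proof.
move=> hC.
pose Q a A := (traces Sp C a A /\ rk A a < a) \/
  [/\ Sp a, A = C a & forall B, traces Sp C a B -> ~ rk B a < a].
have Qshort a A : Q a A -> short_club A a.
  case=> [[[c [Sc Cca] <-] ra]|[Sa -> _]]; last exact: hC.
  apply: short_club_below; [exact: hC|exact: Cca|].
  by rewrite rk_below in ra.
exists (fun a => trim @` Q a); split.
- move=> a Sa; have [[A [tA rA]]|no] := pselect (exists A, traces Sp C a A /\ rk A a < a).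
    by exists (trim A), A => //; left.
  by exists (trim (C a)), (C a) => //; right; split=> // B tB rB; apply: no; exists B.
- by move=> a _ [A /Qshort + <-]; exact: trim_short_club.
- move=> a _ b [A QA <-] tb; exists (A `&` below b); last by rewrite trim_below.
  left; split; last by rewrite rk_below//; exact: trim_rk.
  have [Ab _] := tb; have [Aa _ _ _ _] := Qshort _ _ QA; have ba := Aa _ Ab.
  case: QA Ab => [[[c [Sc Cca] <-] _] [Ccb _]|[Sa -> _] Cab]; last by exists a.
  exists c => //; rewrite -setIA; congr (_ `&` _); apply/seteqP; split=> x; last by case.
  by move=> xb; split=> //; exact: lt_trans ba.
- move=> a; have [[A [tA rA]]|no] := pselect (exists A, traces Sp C a A /\ rk A a < a).
    left; apply: (card_le_trans (card_image_le _ _)); apply: subset_card_le => B [[]//|[_ _]].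
    by move=> /(_ A tA).
  right=> _ _ [A [[tA rA]|[_ -> _]] <-] [B [[tB rB]|[_ -> _]] <-] //; case: no; first by exists A.
    by exists A.
  by exists B.
Qed.

Lemma short_club_gt0 A a : short_club A a -> below a !=set0.
Proof. by move=> [_ _ h _ _]; exists (rk A a). Qed.

(** With at most one trace at each point, the coherent family consists of single
    sets, which is a square sequence. Conversely the traces at [b] of a square
    sequence are all equal to the set at [b]. *)
Lemma I_const_unit_square : I_const L unit = I_square L.
Proof.
apply/seteqP; split=> S.
  move=> /I_funP[Sp [C [nS hC tr]]]; have [P [P0 Psc Pco Pc]] := coherent_family hC.
  have P1 a : is_subset1 (P a).
    by case: (Pc a) => // h; apply/card_le_unitP; exact: card_le_trans (tr a).
  have [C' hC'] : {C' : L -> set L & forall a, P a !=set0 -> P a (C' a)}.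
    apply: (@choice _ _ (fun a X => P a !=set0 -> P a X)) => a.
    have [[A PA]|no] := pselect (P a !=set0); first by exists A.
    by exists set0.
  exists [set a | P a !=set0]; split.
    case: nS => E [clE SE]; exists E; split=> //; apply/seteqP; split=> // x [[Sx nx] Ex].
    by rewrite -SE; split=> //; split=> // /P0.
  exists C'; split=> a /= Pa; have := Psc _ _ (hC' _ Pa).
  - by move=> [? ? _ _ _]; exact/closed_subsetP.
  - move=> _ b Cb; have Pb := Pco _ _ _ (hC' _ Pa) Cb.
    have Pb0 : P b !=set0 by eexists; exact: Pb.
    by split=> //; rewrite setIC; apply: P1 Pb; exact: hC'.
  - move=> short; have [Ca _ _ lim _] := short; split=> [al|].
      exact/(lub_belowP Ca)/lim.
    by move=> /(lub_belowP Ca); apply: clusters_limit; exact: short_club_gt0 short.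
  - by move=> [Ca _ ? _ _]; exact/(otp_ltP wo).
move=> [Sp [nS [C [h1 h2 h3 h4]]]].
apply/I_funP; exists Sp, C; split=> // [a Sa|b].
  have [Ca cl] := (closed_subsetP _ _).1 (h1 a Sa); split=> //.
  - by apply/otp_ltP => //; exact: h4.
  - by move=> al; apply/(lub_belowP Ca)/h3.
  - move=> b Cb nb; have [Sb Cbb] := h2 a Sa b Cb.
    apply: nonlimit_succ; first by have [e []] := h4 b Sb; exists e.
    by move=> /(h3 _ Sb); rewrite Cbb setIC => /lubP.
apply/card_le_unitP => _ _ [a [Sa Ca] <-] [c [Sc Cc] <-].
by rewrite ![_ `&` below b]setIC; have [_ <-] := h2 a Sa b Ca; have [_ <-] := h2 c Sc b Cc.
Qed.

(** The coherent family of the traces is a weak square sequence. Conversely, any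
    choice of one member at each point has its traces at [b] among the members of
    the family at [b]. *)
Lemma I_fun_below_wsquare : I_fun L (fun i : L => set_type (below i)) = I_wsquare L.
Proof.
apply/seteqP; split=> S.
  move=> /I_funP[Sp [C [nS hC tr]]]; have [P [P0 Psc Pco Pc]] := coherent_family hC.
  exists [set a | P a !=set0]; split.
    case: nS => E [clE SE]; exists E; split=> //; apply/seteqP; split=> // x [[Sx nx] Ex].
    by rewrite -SE; split=> //; split=> // /P0.
  exists P; split=> a /= Pa.
  - split=> // [A /Psc[? ? _ _ _]|al A /Psc[? _ _ lim _]]; first exact/closed_subsetP.
    by apply/(unbounded_clusters _ al); split=> //; exact: lim.
  - by move=> A b PA Ab; have Pb := Pco _ _ _ PA Ab; split=> //; eexists; exact: Pb.
  - case: (Pc a) => h.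
      by rewrite -(card_le_eqr (card_setT (below a))); apply: card_le_trans (tr a).
    by apply: card_le_subset1 => //; have [A /Psc/short_club_gt0] := Pa.
  - by move=> A /Psc[? _ ? _ _]; exact/(otp_ltP wo).
move=> [Sp [nS [P [h1 h2 h3 h4]]]].
have [C hC] : {C : L -> set L & forall a, Sp a -> P a (C a)}.
  apply: (@choice _ _ (fun a X => Sp a -> P a X)) => a.
  have [/h1[[A PA] _ _]|no] := pselect (Sp a); first by exists A.
  by exists set0.
apply/I_funP; exists Sp, C; split=> // [a Sa|b].
  have [_ cl lim] := h1 a Sa; have [Ca {}cl] := (closed_subsetP _ _).1 (cl _ (hC a Sa)).
  split=> //.
  - by apply/otp_ltP => //; apply: h4 => //; exact: hC.
  - by move=> al; have /(unbounded_clusters _ al)[] := lim al _ (hC a Sa).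
  - move=> b Cb nb; have [Sb Pb] := h2 a Sa _ b (hC a Sa) Cb.
    apply: nonlimit_succ; first by have [e []] := h4 b Sb _ Pb; exists e.
    move=> bl; have [_ _ /(_ bl _ Pb)] := h1 b Sb.
    by move=> /(unbounded_clusters _ bl)[_]; rewrite clusters_below.
rewrite (card_le_eqr (card_setT _)).
have [Sb|nSb] := pselect (Sp b).
  apply: card_le_trans (h3 b Sb); apply: subset_card_le => _ [a [Sa Cab] <-].
  by have [] := h2 a Sa _ b (hC a Sa) Cab.
suff -> : traces Sp C b = set0 by [].
apply/seteqP; split=> // A [a [Sa Cab] _]; apply: nSb.
by have [] := h2 a Sa _ b (hC a Sa) Cab.
Qed.

End ShortClubs.

(** * Closures of sets of successors *)

Section Closure.
Context {d : Order.disp_t} {L : orderType d}.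
Context (wo : well_order (<=%O : rel L)).
Implicit Types (a b x y z : L) (A B X : set L).
Local Notation rk := (rk wo).

(** Closure in the order topology. Only limits are added because every set
    vacuously clusters at the least element. *)
Definition clos X : set L := X `|` [set y | is_limit_ordinal y /\ clusters X y].

Lemma clusters_clos X y : clusters (clos X) y <-> clusters X y.
Proof.
split; last by apply: clusters_sub => x _; left.
move=> h x /h[z [[Xz|[_ cz]] xz zy]]; first by exists z.
by have [t [Xt xt tz]] := cz x xz; exists t; split=> //; exact: lt_trans zy.
Qed.

Lemma clos_below X a : clos (X `&` below a) `&` below a = clos X `&` below a.
Proof.
apply/seteqP; split=> x [[Xx|[xl cx]] xa]; split=> //; first by left; case: Xx.
- by right; split=> //; rewrite -(clusters_below _ (ltW xa)).
- by left.
- by right; split=> //; rewrite clusters_below// ltW.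
Qed.

(** The map sending [y] to the next element of [X] is strictly increasing on the
    closure: between two points of the closure, or at the second one, there is an
    element of [X]. *)
Lemma rk_clos X a : clusters X a -> rk (clos X) a <= rk X a.
Proof.
move=> ca.
have [f hf] : {f : L -> L & forall y, y < a -> [/\ X (f y), y < f y, f y < a &
    forall z, X z -> y < z -> f y <= z]}.
  apply: (@choice _ _ (fun y t => y < a ->
    [/\ X t, y < t, t < a & forall z, X z -> y < z -> t <= z])) => y.
  have [/[dup] ya /ca [z [Xz yz za]]|na] := pselect (y < a); last by exists y.
  have [|t [[Xt yt] tmin]] := @least_exists _ _ wo [set z | X z /\ y < z]; first by exists z.
  exists t => _; split=> // [|u Xu yu]; last exact: tmin.
  by apply: le_lt_trans za; exact: tmin.
apply: (@rk_homo_le _ _ wo _ _ f) => [x _ /hf[]//|x y cx cy xy ya].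
have [Xfx xfx fxa fmin] := hf x (lt_trans xy ya); have [Xfy yfy _ _] := hf y ya.
apply: le_lt_trans yfy; case: cy => [Xy|[_ cy]]; first exact: fmin.
by have [z [Xz xz zy]] := cy x xy; apply: le_trans (ltW zy); exact: fmin.
Qed.

Lemma clos_closed X a : closed_subset (clos X `&` below a) (below a).
Proof.
apply/closed_subsetP; split=> [x []//|x xa xl].
by rewrite clusters_below ?ltW// => /clusters_clos cx; split=> //; right.
Qed.

Lemma nacc_clos X a b : nacc (clos X `&` below a) b -> X b.
Proof.
move=> /naccP[[[//|[_ cb]] ba]] []; rewrite clusters_below ?ltW//; exact/clusters_clos.
Qed.

Lemma clos_short_club X a : X `<=` is_succ_ordinal -> clusters X a -> rk X a < a ->
  short_club wo (clos X `&` below a) a.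
Proof.
move=> Xs ca ra; have [Ka cl] := (closed_subsetP _ _).1 (clos_closed X a).
split=> //.
- by rewrite rk_below//; apply: le_lt_trans ra; exact: rk_clos.
- by move=> _; rewrite clusters_below//; apply/clusters_clos.
- move=> b [[/Xs//|[_ cb]] ba] []; rewrite clusters_below ?ltW//; exact/clusters_clos.
Qed.

(** A weakly increasing image of [A] has at most the order type of [A]: choose
    preimages. *)
Lemma rk_image_le (f : L -> L) A a b :
  (forall x y, A x -> A y -> x <= y -> f x <= f y) ->
  (forall x, A x -> f x < a -> x < b) -> rk (f @` A) a <= rk A b.
Proof.
move=> fm fab.
have [g hg] : {g : L -> L & forall y, (f @` A) y -> A (g y) /\ f (g y) = y}.
  apply: (@choice _ _ (fun y x => (f @` A) y -> A x /\ f x = y)) => y.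
  by have [[x Ax <-]|no] := pselect ((f @` A) y); [exists x|exists y].
apply: (@rk_homo_le _ _ wo _ _ g) => [y /hg[Ag e] ya|u v /hg[Au eu] /hg[Av ev] uv _].
  by split=> //; apply: fab => //; rewrite e.
rewrite ltNge; apply/negP => /(fm _ _ Av Au); by rewrite eu ev leNgt uv.
Qed.

End Closure.

(** * Clubs of a regular uncountable cardinal *)

Section Regular.
Context {d : Order.disp_t} {L : orderType d}.
Context (hL : regular_uncountable_cardinal L).
Implicit Types (a b x y z : L) (A B D E X S Sp : set L).
Let wo : well_order (<=%O : rel L) := let: And3 h _ _ := hL in h.
Local Notation rk := (rk wo).

(** The bounds for images and for countable sets below both come from this: an
    unbounded set is never shorter than [L]. *)
Lemma full_otp A : unbounded_in A [set: L] -> rk A @` A = setT.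
Proof.
move=> Au; case: hL => _ [_ _ [_ hcf]] _; apply/seteqP; split=> //.
by apply: hcf Au _; exact: has_otp_rk.
Qed.

(** The cofinality of [D] is at most [a] as soon as some map from [a] is cofinal,
    monotone or not: its values at record points, where it exceeds all earlier
    values, are still cofinal and are enumerated increasingly. *)
Lemma cofinal_map_otp D (h : L -> L) a : (forall x, x < a -> D (h x)) ->
  (forall y, D y -> exists2 x, x < a & y <= h x) ->
  exists A, unbounded_in A D /\ forall y, A y -> rk A y < a.
Proof.
move=> Dh hD.
pose record x := x < a /\ forall y, y < x -> h y < h x.
exists (h @` record); split.
  split=> [_ [x [xa _] <-]|y Dy]; first exact: Dh.
  have [|x [[xa yx] xmin]] := @least_exists _ _ wo [set x | x < a /\ y <= h x].
    by have [x xa yx] := hD y Dy; exists x.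
  exists (h x) => //; exists x => //; split=> // z zx.
  apply: lt_le_trans yx; rewrite ltNge; apply/negP => yz.
  by have := xmin z (conj (lt_trans zx xa) yz); rewrite leNgt zx.
have [g hg] : {g : L -> L & forall y, (h @` record) y -> record (g y) /\ h (g y) = y}.
  apply: (@choice _ _ (fun y x => (h @` record) y -> record x /\ h x = y)) => y.
  by have [[x rx <-]|no] := pselect ((h @` record) y); [exists x|exists y].
have gmono u v : (h @` record) u -> (h @` record) v -> u < v -> g u < g v.
  move=> /hg[[ua ur] eu] /hg[[va vr] ev] uv.
  rewrite ltNge le_eqVlt; apply/negP => /orP[/eqP e|/ur].
    by move: uv; rewrite -eu -ev e ltxx.
  by rewrite eu ev ltNge (ltW uv).
move=> y Ay; have [[ga _] _] := hg y Ay; apply: le_lt_trans ga.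
apply: le_trans (rk_le wo setT (g y)); apply: (@rk_homo_le _ _ wo _ _ g).
  by move=> x Ax xy; split=> //; exact: gmono.
by move=> u v Au Av uv _; exact: gmono.
Qed.

Lemma bounded_image (h : L -> L) a : exists b, forall x, x < a -> h x < b.
Proof.
apply: contrapT => /forallNP no.
have [//|y _|A [/full_otp AT Ara]] := @cofinal_map_otp setT h a.
  have /existsNP[x /not_implyP[xa /negP]] := no y.
  by rewrite -leNgt; exists x.
have : [set: L] a by [].
by rewrite -AT => -[x /Ara + xa]; rewrite xa ltxx.
Qed.

Lemma countable_bounded (h : nat -> L) : exists b, forall n, h n < b.
Proof.
apply: contrapT => /forallNP no; case: (hL) => _ _; apply.
have /full_otp <- : unbounded_in (range h) [set: L].
  split=> // y _; have /existsNP[n /negP] := no y.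
  by rewrite -leNgt; exists (h n) => //; exists n.
apply: (card_le_trans (card_image_le _ _)); apply: (card_le_trans (card_image_le _ _)).
exact: card_leT.
Qed.

Lemma gt_exists x : exists y, x < y.
Proof. by have [b hb] := countable_bounded (fun=> x); exists b; exact: (hb 0%N). Qed.

Definition osucc x := least x [set y | x < y].

Lemma osucc_gt x : x < osucc x.
Proof. by have [] := leastP wo x (gt_exists x). Qed.

Lemma osucc_le x y : x < y -> osucc x <= y.
Proof. by move=> xy; have [_] := leastP wo x (gt_exists x); apply. Qed.

Lemma osucc_succ x : is_succ_ordinal (osucc x).
Proof. by exists x; split; [exact: osucc_gt|exact: osucc_le]. Qed.

Lemma osucc_mono x y : x < y -> osucc x < osucc y.
Proof. by move=> xy; apply: le_lt_trans (osucc_gt y); exact: osucc_le. Qed.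

Lemma osucc_limit x y : is_limit_ordinal y -> x < y -> osucc x < y.
Proof.
move=> yl xy; have [z [_ xz]] := limit_clusters yl xy; apply: le_lt_trans; exact: osucc_le.
Qed.

Definition closed_under (h : L -> L) a := below a !=set0 /\ forall x, x < a -> h x < a.

(** Iterating bounds of the images of [h] from any point, and taking the supremum,
    gives a closed point: countable sets are bounded. *)
Lemma club_closed_under (h : L -> L) : (forall x, x < h x) -> is_club (closed_under h).
Proof.
move=> hx; split; split=> //.
  move=> a _ al /lubP ca; split; first by case: al.
  by move=> x /ca[e [[_ he] xe ea]]; exact: lt_trans (he _ xe) ea.
move=> x0 _; have [k hk] : {k : L -> L & forall b x, x < b -> h x < k b}.
  by apply: (@choice _ _ (fun b y => forall x, x < b -> h x < y)) => b; exact: bounded_image.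
pose b n := iter n k (osucc x0).
have [|a [aub amin]] := @least_exists _ _ wo [set a | forall n, b n <= a].
  by have [a ha] := countable_bounded b; exists a => n; exact: ltW.
have x0a : x0 < a by apply: lt_le_trans (aub 0%N); exact: osucc_gt.
exists a; last exact: ltW.
split=> [|x xa]; first by exists x0.
suff [n xn] : exists n, x < b n by apply: lt_le_trans (aub n.+1); exact: hk.
apply: contrapT => /forallNP no.
suff /amin : [set a | forall n, b n <= a] x by rewrite leNgt xa.
by move=> n; rewrite leNgt; apply/negP.
Qed.

(** Every club contains the points closed under some function, so functions can
    replace clubs, and intersecting clubs becomes taking a maximum of functions. *)
Lemma nonstationaryP S : nonstationary S <->
  exists h : L -> L, forall a, closed_under h a -> ~ S a.
Proof.
split=> [[E [[[_ cl] [_ un]] SE]]|[h hS]]; last first.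
  pose h' x := Order.max (h x) (osucc x).
  exists (closed_under h'); split.
    by apply: club_closed_under => x; rewrite lt_max osucc_gt orbT.
  apply/seteqP; split=> // x [Sx [x0 hx]]; apply: (hS x) => //; split=> // y /hx.
  by rewrite gt_max => /andP[].
have [h hE] : {h : L -> L & forall x, E (h x) /\ x < h x}.
  apply: (@choice _ _ (fun x y => E y /\ x < y)) => x.
  by have [y Ey xy] := un (osucc x) I; exists y; split=> //; apply: lt_le_trans xy; exact: osucc_gt.
exists h => a [a0 ha] Sa; suff : (S `&` E) a by rewrite SE.
have ca : clusters E a by move=> x xa; have [] := hE x; exists (h x); split=> //; exact: ha.
by split=> //; apply: cl => //; [exact: clusters_limit ca|exact/lubP].
Qed.

Lemma nonstationary_shrink S Sp Sp' (h : L -> L) : nonstationary (S `\` Sp) ->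
  (forall a, Sp a -> closed_under h a -> Sp' a) -> nonstationary (S `\` Sp').
Proof.
move=> /nonstationaryP[k hk] hS; apply/nonstationaryP.
exists (fun x => Order.max (k x) (h x)) => a [a0 ha] [Sa nSa].
apply: (hk a); first by split=> // x /ha; rewrite gt_max => /andP[].
split=> // Spa; apply: nSa; apply: hS => //.
by split=> // x /ha; rewrite gt_max => /andP[].
Qed.

Lemma closed_under_limit (h : L -> L) a : (forall x, x < h x) ->
  closed_under h a -> is_limit_ordinal a.
Proof.
move=> hx [a0 ha]; apply: (@clusters_limit _ _ setT) => // x xa.
by exists (h x); split=> //; exact: ha.
Qed.

(** * Short clubs at noninaccessible points *)

Lemma osucc_monoW x y : x <= y -> osucc x <= osucc y.
Proof.
rewrite le_eqVlt => /orP[/eqP->//|xy]; apply: ltW; exact: osucc_mono.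
Qed.

(** Replacing the elements of [A] by their successors and taking the closure gives
    a club of no larger order type whose isolated points are successors. *)
Lemma singular_short_club A a :
  is_limit_ordinal a -> unbounded_in A (below a) -> rk A a < a ->
  exists T, short_club wo T a.
Proof.
move=> al /(unbounded_clusters _ al)[Aa ca] ra.
exists (clos (osucc @` A) `&` below a); apply: clos_short_club.
- by move=> _ [x _ <-]; exact: osucc_succ.
- move=> x /ca[z [Az xz za]]; exists (osucc z); split; first by exists z.
    by apply: lt_trans xz _; exact: osucc_gt.
  exact: osucc_limit.
- apply: le_lt_trans ra; apply: rk_image_le => [x y _ _|x Ax _]; first exact: osucc_monoW.
  exact: Aa.
Qed.

Lemma regular_below_cardinal a : is_limit_ordinal a ->
  (forall A, unbounded_in A (below a) -> a <= rk A a) -> is_cardinal (below a).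
Proof.
move=> al areg e ea; split.
  by apply: subset_card_le => x xe; exact: lt_trans ea.
move=> /card_le_surj[|h [ha hs]]; first by case: al.
have [//|y ya|A [Au Ae]] := @cofinal_map_otp (below a) h e.
  by have [x xe <-] := hs y ya; exists x.
have := areg A Au; rewrite leNgt => /negP; apply.
apply: le_lt_trans ea; rewrite leNgt; apply/negP => /rk_surj[z [Az _ ez]].
by have := Ae z Az; rewrite ez ltxx.
Qed.

(** Let [h x] bound the next cardinal after [x], if there is one, and a fixed
    infinite sequence. If a point [a] closed under [h] carries no short club, then
    it is regular, hence a cardinal, and it is uncountable. Being itself a cardinal
    above each [k < a], it ensures that there is a next cardinal after [k], which
    lies below [a] by closure. So [a] is inaccessible. *)
Lemma noninaccessible_short_club : exists h : L -> L,
  forall a, closed_under h a -> ~ is_inaccessible a ->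
  exists T, short_club wo T a.
Proof.
have [x0 _] : [set: L] !=set0.
  apply: contrapT => no; case: hL => _ _; apply.
  by have -> : [set: L] = set0; [apply/seteqP; split=> // x _; apply: no; exists x|exact: countable0].
pose iota n := iter n osucc x0.
have [w hw] := countable_bounded iota.
have nat_w : [set: nat] #<= below w.
  have iota_lt m n : (m < n)%N -> iota m < iota n.
    elim: n => // n ih; rewrite ltnS leq_eqVlt => /orP[/eqP->|/ih h]; first exact: osucc_gt.
    by apply: lt_trans h _; exact: osucc_gt.
  have iota_inj : {in [set: nat] &, injective iota}.
    move=> m n _ _ e; apply/eqP; case: ltngtP => // /iota_lt; by rewrite e ltxx.
  rewrite -(card_le_eql (inj_card_eq iota_inj)); apply: subset_card_le => _ [n _ <-].
  exact: hw.
pose nextcard x := least x [set k | x < k /\ is_cardinal (below k)].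
(* If no cardinal lies above x, nextcard x is x and imposes nothing. *)
exists (fun x => Order.max (osucc x) (Order.max w (nextcard x))) => a [a0 ha] na.
have {}ha x : x < a -> [/\ osucc x < a, w < a & nextcard x < a].
  by move=> /ha; rewrite !gt_max => /and3P[].
have al : is_limit_ordinal a.
  apply: (@clusters_limit _ _ setT) => // x xa; exists (osucc x); split=> //; first exact: osucc_gt.
  by have [] := ha x xa.
have wa : w < a by have [x /ha[]] := a0.
apply: contrapT => noC; apply: na.
have areg A : unbounded_in A (below a) -> a <= rk A a.
  move=> Au; rewrite leNgt; apply/negP => ra; apply: noC; exact: singular_short_club ra.
have ac := regular_below_cardinal al areg.
have aunc : ~ countable (below a).
  by move=> ac'; have [_] := ac w wa; apply; exact: card_le_trans nat_w.
split=> //.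
  split=> //; first by move=> /finite_set_countable.
  split.
    exists (below a); split; first by split=> // x xa; exists x.
    by split=> [x y xy|]; [exact: le_lt_trans|exists id; split=> [//|]; rewrite image_id].
  move=> A E Au /(has_otpE wo) ->; rewrite (rk_image_below _ Au.1).
  by move=> x xa; apply: lt_le_trans xa _; exact: areg.
move=> k ka _.
(* a itself is a cardinal above k, so nextcard k is one. *)
have [|[kn cn] _] := leastP wo k (P := [set k' | k < k' /\ is_cardinal (below k')]).
  by exists a.
by exists (nextcard k); split=> //; have [] := ha k ka.
Qed.

(** A sequence indexed by [L] has at most |L| traces anyway, so it suffices to have
    a short club at club many noninaccessible points. *)
Lemma I_const_noninaccessible : I_const L L (~` S_in L).
Proof.
have [h hh] := noninaccessible_short_club.
apply/(I_funP wo); exists [set a | exists T, short_club wo T a].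
have [C hC] : {C : L -> set L & forall a, (exists T, short_club wo T a) -> short_club wo (C a) a}.
  apply: (@choice _ _ (fun a T => (exists T, short_club wo T a) -> short_club wo T a)) => a.
  by have [[C hC]|no] := pselect (exists T, short_club wo T a); [exists C|exists set0].
exists C; split=> //.
  by apply/nonstationaryP; exists h => a /hh ha [na]; apply; exact: ha.
by move=> b; apply: (card_le_trans (card_image_le _ _)); exact: card_leT.
Qed.

(** * The approachability ideal *)

(** The lexicographic order, restricted to predecessors [q] with [q.2 < q.1] when
    the first components differ. The restriction is what makes the set of
    predecessors of a pair bounded under any map to [L]. *)
Definition lex (q p : L * L) : Prop :=
  q.1 < p.1 /\ q.2 < q.1 \/ q.1 = p.1 /\ q.2 < p.2.

Lemma lex_wf : well_founded lex.
Proof.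
move=> [a g]; elim/(wo_lt_ind wo): a g => a iha g.
elim/(wo_lt_ind wo): g => g ihg; constructor=> -[b k] [[/= ba _]|[/= -> kg]]; first exact: iha.
exact: ihg.
Qed.

Lemma bounded_image2 (c : L -> L -> L) a :
  exists b, forall x y, x < a -> y < x -> c x y < b.
Proof.
have [k hk] : {k : L -> L & forall x y, y < x -> c x y < k x}.
  by apply: (@choice _ _ (fun x b => forall y, y < x -> c x y < b)) => x; exact: bounded_image.
have [b hb] := bounded_image k a; exists b => x y xa yx.
exact: lt_trans (hk _ _ yx) (hb _ xa).
Qed.

Lemma lex_bounded (c : L * L -> L) p : exists b, forall q, lex q p -> c q < b.
Proof.
have [b1 h1] := bounded_image2 (fun x y => c (x, y)) p.1.
have [b2 h2] := bounded_image (fun y => c (p.1, y)) p.2.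
exists (Order.max b1 b2) => -[x y] /= [[/= xp yx]|[/= -> yp]]; rewrite lt_max; first by rewrite h1.
by rewrite h2// orbT.
Qed.

(** A pair of an ordinal [a] and some [g < a] is coded by a successor ordinal, in
    such a way that codes increase with [a] whatever the second components are. *)
Lemma coding_exists : exists c : L -> L -> L,
  [/\ forall a g, is_succ_ordinal (c a g), forall a g, a < c a g,
      forall a b g k, g < a -> a < b -> c a g < c b k
    & forall a g k, g < k -> c a g < c a k].
Proof.
pose F (p : L * L) (r : forall q, lex q p -> L) :=
  osucc (least p.1 [set y | p.1 <= y /\ forall q (h : lex q p), r q h <= y]).
pose c := Fix lex_wf (fun=> L) F.
have cE p : c p = osucc (least p.1 [set y | p.1 <= y /\ forall q, lex q p -> c q <= y]).
  rewrite /c Fix_eq// => x f g fg.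
  by have -> : f = g by apply: functional_extensionality_dep => z;
    apply: functional_extensionality_dep => zx; exact: fg.
have cP p : p.1 < c p /\ forall q, lex q p -> c q < c p.
  have [|[h1 h2] _] := leastP wo p.1 (P := [set y | p.1 <= y /\ forall q, lex q p -> c q <= y]).
    have [b hb] := lex_bounded c p; exists (Order.max p.1 b); split.
      by rewrite le_max lexx.
    by move=> q /hb/ltW; rewrite le_max => ->; rewrite orbT.
  by split=> [|q /h2 qp]; rewrite [c p]cE; apply: le_lt_trans (osucc_gt _).
exists (fun a g => c (a, g)); split=> [a g|a g|a b g k ga ab|a g k gk].
- by rewrite cE; exact: osucc_succ.
- by have [] := cP (a, g).
- by apply: (cP (b, k)).2; left.
- by apply: (cP (a, k)).2; right.
Qed.

(** The minimal value [rk U g] is cf [g]. *)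
Lemma least_cofinal g : exists U, unbounded_in U (below g) /\
  forall A, unbounded_in A (below g) -> rk U g <= rk A g.
Proof.
have [|e [[U [Uu <-]] emin]] := @least_exists _ _ wo
    [set e | exists U, unbounded_in U (below g) /\ rk U g = e].
  by exists (rk (below g) g), (below g); split=> //; split=> // x xg; exists x.
by exists U; split=> // A Au; apply: emin; exists A.
Qed.

(** Two things are missing from the given sequence. The set assigned to a
    successor [b] must be determined by [b], and this is repaired by taking the
    unique trace at [b]. The order type of [C a] must be the cofinality of [a]; so
    keep only those elements whose rank in [C a] lies in a fixed set cofinal in
    the order type [g] of [C a], consisting of successors and of order type
    cf [g]. This selection depends on [g], which the elements do not determine;
    so each selected [b > g] is replaced by the code of the pair of [b] and [g]. *)
Lemma I_fun_sub_approach :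
  I_fun L (fun a : L => if `[< is_limit_ordinal a >] then L : cardinal else unit)
    `<=` I_approach L.
Proof.
move=> S /(I_funP wo)[Sp [C [nS hC tr]]].
have coh a a' b : Sp a -> Sp a' -> is_succ_ordinal b -> C a b -> C a' b ->
    C a `&` below b = C a' `&` below b.
  move=> Sa Sa' sb Cab Ca'b; have := tr b; case: asboolP => [[_ //]|_ /card_le_unitP].
  by apply; [exists a|exists a'].
have [c [c_succ c_gt c_lt1 c_lt2]] := coding_exists.
have c_mono a b g : g < a -> a <= b -> c a g <= c b g.
  by move=> ga; rewrite le_eqVlt => /orP[/eqP->//|ab]; apply: ltW; exact: c_lt1.
have c_ltE a b g : g < a -> g < b -> (c a g < c b g) = (a < b).
  move=> ga gb; apply/idP/idP; last exact: c_lt1.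
  by move=> h; rewrite ltNge; apply/negP => /(c_mono _ _ _ gb); rewrite leNgt h.
have c_inj a b g k : g < a -> k < b -> c a g = c b k -> a = b /\ g = k.
  move=> ga kb e; have eab : a = b.
    apply/eqP; case: ltgtP => // h.
      by have := c_lt1 a b g k ga h; rewrite e ltxx.
    by have := c_lt1 b a k g kb h; rewrite e ltxx.
  split=> //; subst b; apply/eqP; case: ltgtP => // h.
    by have := c_lt2 a g k h; rewrite e ltxx.
  by have := c_lt2 a k g h; rewrite e ltxx.
have [U hU] : {U : L -> set L & forall g, unbounded_in (U g) (below g) /\
    forall A, unbounded_in A (below g) -> rk (U g) g <= rk A g}.
  apply: (@choice _ _ (fun g V => unbounded_in V (below g) /\
    forall A, unbounded_in A (below g) -> rk V g <= rk A g)); exact: least_cofinal.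
pose G A g := [set c b g | b in [set b | [/\ A b, g < b & (osucc @` U g) (rk A b)]]].
(* D b is the common trace at b, when b is a successor. *)
pose D b := [set x | exists2 a, Sp a /\ C a b & (C a `&` below b) x].
have DE a b : Sp a -> is_succ_ordinal b -> C a b -> D b = C a `&` below b.
  move=> Sa sb Cab; apply/seteqP; split=> x; last by exists a.
  by move=> [a' [Sa' Ca'b]]; rewrite (coh a' a b).
(* The new set at a, before closing it. The two cases exclude each other, since
   codes are successors, and in the second case a determines b and g. *)
pose X a := [set x | [/\ Sp a, is_limit_ordinal a & G (C a) (rk (C a) a) x] \/
  exists b g, [/\ g < b, is_succ_ordinal b, a = c b g & G (D b) g x]].
have Xlim a : Sp a -> is_limit_ordinal a -> X a = G (C a) (rk (C a) a).
  move=> Sa al; apply/seteqP; split=> x; last by left.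
  move=> [[]//|[b [g [_ _ e _]]]]; case: al => _ []; rewrite e; exact: c_succ.
have Xcode b g : g < b -> is_succ_ordinal b -> X (c b g) = G (D b) g.
  move=> gb sb; apply/seteqP; split=> x; last by right; exists b, g.
  move=> [[_ [_ []]]|[b' [g' [gb' _ e]]]]; first exact: c_succ.
  by have [-> ->] := c_inj _ _ _ _ gb gb' e.
(* In both cases X a is obtained from an initial segment of some C a0. *)
have Xform a x : X a x -> exists a0 t g, Sp a0 /\ X a = G (C a0 `&` below t) g.
  move=> [[Sa al _]|[b [g [gb sb e]]]].
    exists a, a, (rk (C a) a); split=> //; rewrite Xlim//; congr (G _ _).
    by rewrite setIidl//; have [] := hC a Sa.
  move=> [y [[a0 [Sa0 Cb] _] _ _] _]; exists a0, b, g; split=> //.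
  by rewrite e Xcode// (DE a0).
have Xcoh a x : X a x -> X x `&` below x = X a `&` below x.
  move=> /[dup] Xax /Xform[a0 [t [g [Sa0 Xa]]]].
  move: Xax; rewrite Xa => -[b [[Cb bt] gb eb] <-].
  have {}eb : (osucc @` U g) (rk (C a0) b) by rewrite (rk_below _ _ (ltW bt)) in eb.
  have sb : is_succ_ordinal b.
    have [_ _ _ _ ] := hC a0 Sa0; apply=> //; apply: succ_rk_not_clusters.
    by case: eb => u _ <-; exact: osucc_succ.
  rewrite Xcode// (DE a0)//; apply/seteqP; split=> _ [[k [[Ck kb] gk ek] <-] cb]; split=> //.
    exists k => //; split=> //; first by split=> //; exact: lt_trans bt.
    by rewrite rk_below ?ltW// in ek; rewrite rk_below// ltW//; exact: lt_trans bt.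
  have kb' : k < b by rewrite -(c_ltE k b g).
  exists k => //; split=> //.
  by rewrite rk_below ?ltW// in ek; rewrite rk_below// ltW.
have X_succ a x : X a x -> is_succ_ordinal x.
  by move=> /[dup] Xx /Xform[a0 [t [g [_ Xa]]]]; move: Xx; rewrite Xa => -[b _ <-]; exact: c_succ.
(* Closure under h puts the codes used for C a below a. *)
have [h hh] : {h : L -> L & forall b g, g < b -> c b g < h b}.
  by apply: (@choice _ _ (fun b y => forall g, g < b -> c b g < y)) => b; exact: bounded_image.
exists [set a | Sp a /\ closed_under (fun x => Order.max (osucc x) (h x)) a]; split.
  by apply: (nonstationary_shrink nS) => a Sa ca; split; [exact: Sa|exact: ca].
exists (fun a => clos (X a) `&` below a); split.
- by move=> a; exact: clos_closed.
- move=> a b nb; have Xab := nacc_clos nb; have [[_ ba] _] := nb.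
  rewrite -[LHS]clos_below (Xcoh a)// clos_below; apply/seteqP; split=> x; last by case=> ? [].
  by move=> [? xb]; split=> //; split=> //; exact: lt_trans ba.
- move=> a [Sa /[dup] ca [a0 ha]].
  have al : is_limit_ordinal a.
    by apply: closed_under_limit ca => x; rewrite lt_max osucc_gt.
  have {}ha x : x < a -> h x < a by move=> /ha; rewrite gt_max => /andP[].
  have [Ca _ ra /(_ al) cofC _] := hC a Sa.
  set g := rk (C a) a in ra.
  have Xa : X a = G (C a) g by exact: Xlim.
  have rk_g x : x < a -> rk (C a) x < g.
    move=> /cofC[z [Cz xz za]]; apply: le_lt_trans (rk_lt wo Cz za); exact/rk_mono/ltW.
  have gl : is_limit_ordinal g.
    apply: (@clusters_limit _ _ setT); first by have [x xa] := a0; exists (rk (C a) x); exact: rk_g.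
    move=> y /rk_surj[z [Cz za <-]]; have [t [Ct zt ta]] := cofC z za.
    by exists (rk (C a) t); split=> //; [exact: rk_lt|exact: rk_lt].
  have [[Ug Uunb] Umin] := hU g.
  have cofX : clusters (X a) a.
    move=> x xa; have [|z0 [Cz0 + z0a]] := cofC (Order.max x g); first by rewrite gt_max xa.
    rewrite gt_max => /andP[xz0 gz0].
    have [u Uu zu] := Uunb (rk (C a) z0) (rk_g _ z0a).
    have [z [Cz za ez]] := rk_surj (osucc_limit gl (Ug _ Uu)).
    have z0z : z0 < z.
      rewrite ltNge; apply/negP => /(rk_mono wo (C a)); rewrite ez.
      by rewrite leNgt (le_lt_trans zu (osucc_gt u)).
    have gz := lt_trans gz0 z0z.
    exists (c z g); split.
    + by rewrite Xa; exists z => //; split=> //; exists u.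
    + by apply: lt_trans (c_gt z g); exact: lt_trans z0z.
    + by apply: lt_trans (ha z za); exact: hh.
  set K := clos (X a) `&` below a.
  have KA : K `<=` below a by move=> x [].
  have cofK : clusters K a by apply/clusters_below => //; exact/clusters_clos.
  (* K has order type at most cf g: go from K to X a, and from the code of b and
     g to the rank of b in C a, which is the successor of an element of U g. *)
  have rkK : rk K a <= rk (U g) g.
    rewrite rk_below//; apply: le_trans (rk_clos wo cofX) _; rewrite Xa.
    have [f hf] : {f : L -> L & forall x, G (C a) g x -> exists b,
        [/\ C a b, g < b, c b g = x, U g (f x) & osucc (f x) = rk (C a) b]}.
      apply: (@choice _ _ (fun x u => G (C a) g x -> exists b,
        [/\ C a b, g < b, c b g = x, U g u & osucc u = rk (C a) b])) => x.
      have [[b [Cb gb [u Uu eu]] <-]|no] := pselect (G (C a) g x); last by exists x.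
      by exists u => _; exists b.
    apply: (@rk_homo_le _ _ wo _ _ f) => [x /hf[b [_ _ _ Uf _]] _|].
      by split=> //; exact: Ug.
    move=> x y /hf[b [Cb gb <- Ux ex]] /hf[b' [Cb' gb' <- Uy ey]]; rewrite c_ltE// => bb' _.
    rewrite ltNge; apply/negP => /osucc_monoW; rewrite ex ey.
    by rewrite leNgt rk_lt.
  split; first exact/(lub_belowP KA).
  exists (rk K a); split; first exact: has_otp_below.
    split.
      exists K; split; last exact: has_otp_below.
      exact/(unbounded_clusters _ al).
    move=> A E Au /(has_otpE wo) ->; rewrite (rk_image_below _ Au.1) => x /= xK.
    apply: lt_le_trans xK _; apply: le_trans rkK _.
    (* cf g is at most the order type of A: collapse C a onto g. *)
    have imA : unbounded_in (rk (C a) @` A) (below g).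
      split=> [_ [y /Au.1 ya <-]|y /rk_surj[z [Cz za <-]]]; first exact: rk_g.
      by have [t At zt] := Au.2 z za; exists (rk (C a) t); [exists t|exact: rk_mono].
    apply: le_trans (Umin _ imA) _; apply: rk_image_le => [y z _ _|y Ay _].
      exact: rk_mono.
    exact: Au.1.
  by apply: le_lt_trans rkK _; apply: le_lt_trans ra; exact: rk_le.
- by move=> a b /nacc_clos; exact: X_succ.
Qed.

(** The sequence is short by definition. The traces at a limit point are bounded
    trivially, while a successor point of [C a] is an isolated point, where
    coherence makes the trace unique. *)
Lemma approach_sub_I_fun : I_approach L `<=`
  I_fun L (fun a : L => if `[< is_limit_ordinal a >] then L : cardinal else unit).
Proof.
move=> S [Sp [nS [C [cl coh hSp ns]]]].
apply/(I_funP wo); exists Sp, C; split=> // [a Sa|b].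
  have [Ca {}cl] := (closed_subsetP _ _).1 (cl a).
  have [lub [e [otpe _ ea]]] := hSp a Sa; split=> //.
  - by apply/(otp_ltP wo Ca); exists e.
  - by move=> _; apply/(lub_belowP Ca).
  - by move=> b Cb nb; apply: (ns a); apply/naccP.
case: asboolP => [_|nl].
  by apply: (card_le_trans (card_image_le _ _)); exact: card_leT.
apply/card_le_unitP => _ _ [a [Sa Cab] <-] [a' [Sa' Ca'b] <-].
have [b0|nb0] := pselect (below b !=set0); last first.
  by apply/seteqP; split=> x [_ xb]; case: nb0; exists x.
have nb : ~ clusters (C a) b /\ ~ clusters (C a') b.
  by split; apply: succ_not_clusters; exact: nonlimit_succ.
rewrite setIC -(coh a b); last by apply/naccP; case: nb.
by rewrite (coh a' b) 1?setIC//; apply/naccP; case: nb.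
Qed.

End Regular.

Theorem theorem3p6 (d : Order.disp_t) (L : orderType d)
    (hL : regular_uncountable_cardinal L) :
  [/\ I_fun L (fun a : L => if `[< is_limit_ordinal a >] then L : cardinal else unit)
        = I_approach L,
      I_const L unit = I_square L,
      I_fun L (fun i : L => set_type (below i)) = I_wsquare L
    & I_const L L (~` S_in L)].
Proof.
have wo : well_order (<=%O : rel L) by case: hL.
split.
- by apply/seteqP; split; [exact: I_fun_sub_approach|exact: approach_sub_I_fun].
- exact: I_const_unit_square.
- exact: I_fun_below_wsquare.
- exact: I_const_noninaccessible.
Qed.
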